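(* Let $G$ be a finite, simple, connected graph with at least two vertices, and let $G\circ K_1$ be its simple corona graph. Then $$\mathrm{QEC}(G\circ K_1)=\mathrm{QEC}(G)-1+\sqrt{1+(\mathrm{QEC}(G))^2}.$$
   Context: All graphs are finite, simple, connected and unweighted. For a graph $G=(V,E)$, the distance matrix $D_G$ is the real symmetric $V\times V$ matrix whose $(v,w)$ entry is the length of a shortest path joining $v$ and $w$ (and $0$ if $v=w$). Let $C(V)$ be the space of real-valued functions on $V$, with canonical inner product $\langle\cdot,\cdot\rangle$, and let $e\in C(V)$ be the constant function $1$. For a graph $G$ with at least two vertices, the quadratic embedding constant is $$\mathrm{QEC}(G)=\max\{\langle f,D_Gf\rangle : f\in C(V),\ \langle f,f\rangle=1,\ \langle e,f\rangle=0\}.$$ For graphs $G_1$, $G_2$ on disjoint sets of $m$ and $n$ vertices respectively, the corona $G_1\circ G_2$ is the graph obtained by taking one copy of $G_1$ and $m$ copies of $G_2$, and joining the $i$-th vertex of $G_1$ to every vertex in the $i$-th copy of $G_2$. When $G_2=K_1$ (a single vertex), $G\circ K_1$ is called a simple corona graph; thus it is obtained from $G$ by attaching one new pendant vertex to each vertex of $G$. *)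

(* Defs.v *)
From HB Require Import structures.
From mathcomp Require Import all_boot all_order all_algebra.
From mathcomp Require Import all_classical all_reals all_analysis.

Set Implicit Arguments.
Unset Strict Implicit.
Unset Printing Implicit Defensive.
Import Order.TTheory GRing.Theory Num.Theory.
Import numFieldNormedType.Exports.

Local Open Scope classical_set_scope.
Local Open Scope ring_scope.

Record graph := Graph {
  vertex :> finType;
  edge : rel vertex;
  edge_sym : symmetric edge;
  edge_irrefl : irreflexive edge;
  graph_connected : forall x y : vertex, connect edge x y
}.

Section Distance.
Variable G : graph.

(* [x :: p] is a path of length [size p = n], with pairwise distinct
   vertices, from [x] to [y]. *)
Definition has_path_of_length (x y : G) (n : nat) : bool :=
  [exists p : n.-tuple G,
     [&& path (@edge G) x p, uniq (x :: p) & last x p == y]].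

Lemma ex_path_length (x y : G) : exists n, has_path_of_length x y n.
Proof.
have /connectP[p xp ->] := graph_connected x y.
case/shortenP: xp => q xq uq _.
by exists (size q); apply/existsP; exists (in_tuple q); rewrite xq uq eqxx.
Qed.

Definition dist (x y : G) : nat := ex_minn (ex_path_length x y).

Lemma dist_self (x : G) : dist x x = 0%N.
Proof.
rewrite /dist; case: ex_minnP => n _ /(_ 0%N).
rewrite leqn0 => /(_ _)/eqP; apply.
by apply/existsP; exists [tuple]; rewrite /= eqxx.
Qed.

End Distance.

Section QEC.
Variables (R : realType) (G : graph).

Definition distmx (v w : G) : R := (dist v w)%:R.

Definition distmx_apply (f : {ffun G -> R}) : {ffun G -> R} :=
  [ffun v => \sum_w distmx v w * f w].

Definition inner (f g : {ffun G -> R}) : R := \sum_v f v * g v.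

Definition one_fun : {ffun G -> R} := [ffun=> 1].

Definition QEC_values : set R :=
  [set inner f (distmx_apply f) |
     f in [set f | inner f f = 1 /\ inner one_fun f = 0]].

(* This supremum is a maximum as soon as [G] has at least two vertices, see
   [QEC_max] below. *)
Definition QEC : R := sup QEC_values.

End QEC.

Arguments distmx R {G}.
Arguments QEC_values : clear implicits.
Arguments QEC : clear implicits.

Section QECMax.
Variables (R : realType) (G : graph).

Lemma QEC_max : (1 < #|G|)%N ->
  QEC_values R G (QEC R G) /\ ubound (QEC_values R G) (QEC R G).
Proof.
move=> hG; pose n := #|G|.
pose F (u : 'rV[R]_n) : {ffun G -> R} := [ffun v => u ord0 (enum_rank v)].
pose U (f : {ffun G -> R}) : 'rV[R]_n := \row_i f (enum_val i).
have UK f : F (U f) = f by apply/ffunP => v; rewrite !ffunE mxE enum_rankK.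
have cF v : continuous (fun u : 'rV[R]_n => F u v).
  move=> u; under eq_fun do rewrite ffunE.
  exact: coord_continuous.
have csum (h : G -> 'rV[R]_n -> R) :
    (forall v, continuous (h v)) -> continuous (fun u => \sum_v h v u).
  by move=> ch; apply: continuous_big => [|v _]; [exact: add_continuous | exact: ch].
have cM (g h : 'rV[R]_n -> R) :
    continuous g -> continuous h -> continuous (fun u => g u * h u).
  by move=> cg ch u; exact: cvgM (cg u) (ch u).
have cC (c : R) : continuous (fun _ : 'rV[R]_n => c).
  by move=> u; exact: cst_continuous.
have cD v : continuous (fun u => distmx_apply (F u) v).
  under eq_fun do rewrite ffunE.
  by apply: csum => w; exact: cM.
have cQ : continuous (fun u => inner (F u) (distmx_apply (F u))).
  by apply: csum => v; exact: cM.
have cN : continuous (fun u => inner (F u) (F u)).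
  by apply: csum => v; exact: cM.
have cE : continuous (fun u => inner (one_fun R G) (F u)).
  by apply: csum => v; exact: cM.
pose A : set 'rV[R]_n := (fun u => inner (F u) (F u)) @^-1` [set 1] `&`
  (fun u => inner (one_fun R G) (F u)) @^-1` [set 0].
have clA : closed A.
  apply: closedI; apply: preimage_closed => [u _|]; [exact: cN
    | exact: closed_eq | exact: cE | exact: closed_eq].
have bA : bounded_set A.
  exists 1; split; first exact: num_real.
  move=> M M1 u [/= uu _].
  apply/(le_trans _ (ltW M1)).
  rewrite [X in X <= _]mx_normrE.
  apply/bigmax_leP; split => // -[i j] _ /=.
  rewrite -(@ler_pXn2r _ 2) ?nnegrE // expr1n real_normK ?num_real // -uu.
  rewrite /inner (bigD1 (enum_val j)) //= ffunE enum_valK (ord1 i) -expr2 lerDl.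
  by apply: sumr_ge0 => v _; rewrite -expr2 sqr_ge0.
have A0 : A !=set0.
  have /card_gt1P[a [b [_ _ ab]]] := hG.
  pose c : R := (Num.sqrt 2)^-1.
  have c2 : c * c = 2^-1 by rewrite -expr2 exprVn sqr_sqrtr.
  pose f : {ffun G -> R} :=
    [ffun v => if v == a then c else if v == b then - c else 0].
  exists (U f); split; rewrite /= UK /inner (bigD1 a) //= (bigD1 b) 1?eq_sym //=.
    rewrite big1 => [|v /andP[/negPf va /negPf vb]]; last by rewrite !ffunE va vb mul0r.
    rewrite !ffunE !eqxx eq_sym (negPf ab) mulrNN c2 addr0.
    by rewrite -mulr2n -(mulr_natr (2^-1)) mulVf // pnatr_eq0.
  rewrite big1 => [|v /andP[/negPf va /negPf vb]]; last by rewrite !ffunE va vb mulr0.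
  by rewrite !ffunE !eqxx eq_sym (negPf ab) !mul1r addr0 subrr.
have [u Au umax] := compact_EVT_max A0 (bounded_closed_compact bA clA)
  (continuous_subspaceT cQ).
have ub : ubound (QEC_values R G) (inner (F u) (distmx_apply (F u))).
  move=> _ [f [f1 f0] <-]; rewrite -{1 2}(UK f).
  by apply: umax; rewrite inE; split; rewrite /= UK.
have mem : QEC_values R G (inner (F u) (distmx_apply (F u))).
  by exists (F u) => //; move: Au; rewrite inE => -[].
have -> : QEC R G = inner (F u) (distmx_apply (F u)).
  apply/eqP; rewrite eq_le; apply/andP; split.
    by apply: ge_sup => //; exists (inner (F u) (distmx_apply (F u))).
  by apply: ub_le_sup => //; exists (inner (F u) (distmx_apply (F u))).
by split.
Qed.

End QECMax.

Section Corona.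
Variables G1 G2 : graph.

(* [inl i] is the vertex [i] of [G1]; [inr (i, x)] is the vertex [x] in the
   [i]-th copy of [G2]. *)
Definition corona_edge : rel (G1 + G1 * G2)%type := fun u v =>
  match u, v with
  | inl i, inl j => edge i j
  | inl i, inr (j, _) => i == j
  | inr (i, _), inl j => i == j
  | inr (i, x), inr (j, y) => (i == j) && edge x y
  end.

Lemma corona_sym : symmetric corona_edge.
Proof.
by case=> [i|[i x]] [j|[j y]] //=; rewrite ?(edge_sym x) 1?(edge_sym i) // eq_sym.
Qed.

Lemma corona_irrefl : irreflexive corona_edge.
Proof. by case=> [i|[i x]] /=; rewrite edge_irrefl ?andbF. Qed.

Lemma corona_connected u v : connect corona_edge u v.
Proof.
have base i j : connect corona_edge (inl i) (inl j).
  have /connectP[p + ->] := graph_connected i j.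
  elim: p i => [|k p IHp] i //= /andP[ik kp].
  exact: connect_trans (@connect1 _ corona_edge (inl i) (inl k) ik) (IHp _ kp).
pose proj (w : (G1 + G1 * G2)%type) := match w with inl i => i | inr (i, _) => i end.
have to_base w : connect corona_edge w (inl (proj w)).
  by case: w => [i|[i x]] //=; apply: connect1; rewrite /= eqxx.
apply: connect_trans (to_base u) (connect_trans (base _ (proj v)) _).
by rewrite (sym_connect_sym corona_sym).
Qed.

Definition corona : graph :=
  Graph corona_sym corona_irrefl corona_connected.

End Corona.

Lemma K1_connected (x y : unit) : connect (fun _ _ : unit => false) x y.
Proof. by case: x y => -[]; exact: connect0. Qed.

Definition K1 : graph :=
  @Graph unit (fun _ _ => false) (fun _ _ => erefl) (fun _ => erefl) K1_connected.

(* Main.v *)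
Require Import Defs.
From mathcomp Require Import all_boot all_order all_algebra all_reals.
From mathcomp Require Import classical_sets ring lra.
Import Order.TTheory GRing.Theory Num.Theory.
Local Open Scope ring_scope.

(** A function [f] on the corona is a pair [(a, b)] of functions on [G], with
[a] on the old vertices and [b] on the pendant ones.  The unique edge at a
pendant vertex is used by every path that leaves it, so distances in the corona
are those of [G] plus 1 for each pendant end, except that a pendant vertex is
at distance 0 from itself ([dist_corona_K1]).  Hence, with [g = a + b] of zero
sum, the rank-one corrections cancel and
[[
  <f, D f> = <g, D g> - 2 <b, b>,     <f, f> = <g, g> - 2 <g, b> + 2 <b, b>
]]
(by [inner_distmx_corona], and by [inner_corona] with [a = g - b]).  Let [q = QEC G].  Since
[<g, D g> <= q <g, g>], with equality for a suitable [g], the problem reduces to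
the binary quadratic forms [q x^2 - 2 y^2] and [x^2 - 2 x y + 2 y^2], applied
to [x = g v] and [y = b v] and summed over [v].  The largest [l] for which the
pencil [l (x^2 - 2 x y + 2 y^2) - (q x^2 - 2 y^2)] degenerates is the larger root
of
[[
  (l - q) (2 l + 2) - l^2 = 0,
]]
that is [l = q - 1 + sqrt (1 + q^2)], and there the pencil is, up to the
positive factor [2 l + 2], the square [(l x - (2 l + 2) y)^2].  So [l] bounds
[<f, D f>] on unit vectors of zero sum, and it is attained when [g] is
proportional to a maximizer for [G] and [(2 l + 2) b = l g]. *)

(** * Distances *)

Lemma dist_le_size (G : graph) (x : G) (p : seq G) :
  path (@edge G) x p -> (dist x (last x p) <= size p)%N.
Proof.
case/shortenP=> q xq uq sqp.
apply: (@leq_trans (size q)); last first.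
  by apply: uniq_leq_size sqp; case/andP: uq.
rewrite /dist; case: ex_minnP => n _; apply.
by apply/existsP; exists (in_tuple q); rewrite xq uq eqxx.
Qed.

Lemma dist_pathP (G : graph) (x y : G) :
  exists p : seq G, [/\ path (@edge G) x p, last x p = y & size p = dist x y].
Proof.
rewrite /dist; case: ex_minnP => n /existsP[p /and3P[xp _ /eqP lp]] _.
by exists p; rewrite size_tuple.
Qed.

(** [phi] stands for the distance to [y]: the second hypothesis keeps every path
to [y] from being shorter than [phi], and the third one builds a path of that
length by descent. *)
Lemma dist_unique (G : graph) (y : G) (phi : G -> nat) :
    phi y = 0%N ->
    (forall x z : G, edge x z -> (phi x <= (phi z).+1)%N) ->
    (forall x : G, x != y -> exists2 z : G, edge x z & phi x = (phi z).+1) ->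
  forall x : G, dist x y = phi x.
Proof.
move=> phiy lip desc x; apply/eqP; rewrite eqn_leq; apply/andP; split.
  have [n] := ubnP (phi x); elim: n x => // n IHn x.
  have [-> _|/desc[z xz ->]] := eqVneq x y; first by rewrite dist_self.
  rewrite ltnS => /IHn zy; have [p [zp lp sp]] := dist_pathP G z y.
  have := dist_le_size G x (z :: p); rewrite /= xz zp lp sp => /(_ isT).
  by move/leq_trans; apply.
have [p [xp lp <-]] := dist_pathP G x y.
elim: p x xp lp => [x _ /= ->|z p IHp x /= /andP[xz zp] lp]; first by rewrite phiy.
by apply: leq_trans (lip _ _ xz) _; exact: IHp zp lp.
Qed.

Lemma dist_edge_le (G : graph) (x y z : G) :
  edge x z -> (dist x y <= (dist z y).+1)%N.
Proof.
move=> xz; have [p [zp <- <-]] := dist_pathP G z y.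
by apply: (dist_le_size G x (z :: p)); rewrite /= xz.
Qed.

Lemma dist_descent (G : graph) (x y : G) :
  x != y -> exists2 z : G, edge x z & dist x y = (dist z y).+1.
Proof.
have [[|z p] [/= xp lp sp]] := dist_pathP G x y; first by rewrite lp eqxx.
move=> _; case/andP: xp => xz zp; exists z => //.
apply/eqP; rewrite eqn_leq dist_edge_le //= -sp ltnS -lp.
exact: dist_le_size.
Qed.

Definition corona_K1_dist (G : graph) (u v : corona G K1) : nat :=
  match u, v with
  | inl i, inl j => dist i j
  | inl i, inr (j, _) => (dist i j).+1
  | inr (i, _), inl j => (dist i j).+1
  | inr (i, _), inr (j, _) => if i == j then 0 else (dist i j).+2
  end.

(** Descent steps from a pendant vertex to its only neighbour, and from an old
vertex along a geodesic of [G], until the base point of [v] is reached; the last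
step, if any, goes up to the pendant vertex [v]. *)
Lemma dist_corona_K1 (G : graph) (u v : corona G K1) :
  dist u v = corona_K1_dist G u v.
Proof.
move: u; apply: dist_unique => [|u w|u].
- by case: v => [i|[i []]] /=; rewrite ?dist_self ?eqxx.
- case: u w v => [i|[i []]] [k|[k []]] [j|[j []]] //=; rewrite ?andbF //.
  + exact: dist_edge_le.
  + exact: dist_edge_le.
  + by move/eqP->; rewrite ltnW.
  + by move/eqP->; case: eqVneq => [->|_]; rewrite ?dist_self // ltnW.
  + by move/eqP->.
  + by move/eqP->; case: eqP.
case: u v => [i|[i []]] [j|[j []]] /=.
- have [->|/dist_descent[k ik e] _] := eqVneq i j; first by rewrite eqxx.
  by exists (inl k).
- have [-> _|/dist_descent[k ik e] _] := eqVneq i j.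
    by exists (inr (j, tt)); rewrite /= ?eqxx ?dist_self.
  by exists (inl k) => //=; rewrite e.
- by exists (inl i) => //=; rewrite eqxx.
- have [->|ij] := eqVneq i j; first by rewrite eqxx.
  by exists (inl i) => //=; rewrite eqxx.
Qed.

(** * Quadratic forms on the corona *)

Section QuadraticForm.
Variables (R : realType) (G : graph).
Implicit Types a b g : {ffun G -> R}.

Lemma sum_corona_K1 (F : corona G K1 -> R) :
  \sum_u F u = \sum_v F (inl v) + \sum_v F (inr (v, tt)).
Proof.
rewrite [LHS]big_sumType /=; congr (_ + _).
rewrite (reindex (fun v : G => (v, tt))) //=.
by exists fst => // -[v []].
Qed.

Definition corona_fun a b : {ffun corona G K1 -> R} :=
  [ffun u => match u with inl v => a v | inr (v, _) => b v end].

Lemma corona_funP (f : {ffun corona G K1 -> R}) :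
  f = corona_fun [ffun v => f (inl v)] [ffun v => f (inr (v, tt))].
Proof. by apply/ffunP => -[v|[v []]]; rewrite !ffunE. Qed.

Lemma inner_one (H : graph) (f : {ffun H -> R}) :
  inner (Defs.one_fun R H) f = \sum_v f v.
Proof. by apply: eq_bigr => v _; rewrite ffunE mul1r. Qed.

Lemma inner_one_corona a b :
  inner (Defs.one_fun R _) (corona_fun a b) = \sum_v (a v + b v).
Proof.
rewrite inner_one sum_corona_K1 big_split /=.
by congr (_ + _); apply: eq_bigr => v _; rewrite ffunE.
Qed.

Lemma inner_corona a b :
  inner (corona_fun a b) (corona_fun a b) = inner a a + inner b b.
Proof.
rewrite /inner sum_corona_K1.
by congr (_ + _); apply: eq_bigr => v _; rewrite !ffunE.
Qed.

Lemma distmx_apply_corona_inl a b v :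
  distmx_apply (corona_fun a b) (inl v)
    = distmx_apply [ffun w => a w + b w] v + \sum_w b w.
Proof.
rewrite !ffunE sum_corona_K1 -!big_split /=; apply: eq_bigr => w _.
by rewrite !ffunE /distmx !dist_corona_K1 /= -natr1; ring.
Qed.

Lemma distmx_apply_corona_inr a b v :
  distmx_apply (corona_fun a b) (inr (v, tt))
    = distmx_apply [ffun w => a w + b w] v
      + \sum_w (a w + b w) + \sum_w b w - 2 * b v.
Proof.
rewrite !ffunE sum_corona_K1.
(* The diagonal term becomes a sum, so that both sides compare termwise. *)
have -> : 2 * b v = \sum_w (if w == v then 2 * b w else 0).
  by rewrite -big_mkcond big_pred1_eq.
rewrite -sumrN -!big_split /=; apply: eq_bigr => w _.
rewrite !ffunE /distmx !dist_corona_K1 /= eq_sym.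
by case: eqVneq => [->|_]; rewrite ?dist_self -?natr1; ring.
Qed.

(** By [distmx_apply_corona_inl] and [distmx_apply_corona_inr], the function
[D f] is that of [g] at the base point, plus the constant [\sum_w b w], minus
[2 * b v] at pendant vertices.  The constant pairs to 0 with [f]. *)
Lemma inner_distmx_corona a b (g := [ffun v => a v + b v] : {ffun G -> R}) :
    \sum_v (a v + b v) = 0 ->
  inner (corona_fun a b) (distmx_apply (corona_fun a b))
    = inner g (distmx_apply g) - 2 * inner b b.
Proof.
move=> g0; rewrite /inner sum_corona_K1.
under eq_bigr do rewrite distmx_apply_corona_inl ffunE.
under [X in _ + X]eq_bigr do rewrite distmx_apply_corona_inr ffunE g0 addr0.
rewrite -/g mulr_sumr -sumrN -!big_split /=.
set B := \sum_w b w.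
transitivity (\sum_v (g v * distmx_apply g v - 2 * (b v * b v) + B * (a v + b v))).
  by apply: eq_bigr => v _; rewrite [g v]ffunE; ring.
by rewrite big_split /= -mulr_sumr g0 mulr0 addr0.
Qed.

End QuadraticForm.

(** * The constant as a Rayleigh quotient *)

Section Rayleigh.
Variables (R : realType) (G : graph).

Lemma inner_scale (c : R) (f : {ffun G -> R}) :
  inner [ffun v => c * f v] [ffun v => c * f v] = c ^+ 2 * inner f f.
Proof. by rewrite /inner mulr_sumr; apply: eq_bigr => v _; rewrite !ffunE; ring. Qed.

Lemma inner_distmx_scale (c : R) (f : {ffun G -> R}) :
  inner [ffun v => c * f v] (distmx_apply [ffun v => c * f v])
    = c ^+ 2 * inner f (distmx_apply f).
Proof.
rewrite /inner mulr_sumr; apply: eq_bigr => v _; rewrite !ffunE.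
under eq_bigr do rewrite ffunE mulrCA.
by rewrite -mulr_sumr; ring.
Qed.

Lemma sum_scale (c : R) (f : {ffun G -> R}) :
  \sum_v f v = 0 -> \sum_v [ffun v => c * f v] v = 0.
Proof. by move=> f0; under eq_bigr do rewrite ffunE; rewrite -mulr_sumr f0 mulr0. Qed.

Lemma inner_ge0 (f : {ffun G -> R}) : 0 <= inner f f.
Proof. by apply: sumr_ge0 => v _; rewrite -expr2 sqr_ge0. Qed.

Lemma inner_eq0 (f : {ffun G -> R}) : inner f f = 0 -> forall v, f v = 0.
Proof.
move=> f0 v; apply/eqP; rewrite -sqrf_eq0 expr2.
move/eqP: f0; rewrite psumr_eq0 => [/allP/(_ v)|w _]; last by rewrite -expr2 sqr_ge0.
by rewrite mem_index_enum => /(_ isT).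
Qed.

(** Homogeneity removes the normalization in the definition of [QEC]. *)
Lemma inner_distmx_le (hG : (1 < #|G|)%N) (f : {ffun G -> R}) :
  \sum_v f v = 0 -> inner f (distmx_apply f) <= QEC R G * inner f f.
Proof.
move=> f0; have [ff0|ffN0] := eqVneq (inner f f) 0.
  rewrite ff0 mulr0 /inner big1 // => v _.
  by rewrite (inner_eq0 f ff0) mul0r.
have ffp : 0 < inner f f by rewrite lt_def ffN0 inner_ge0.
pose c := (Num.sqrt (inner f f))^-1.
have c2 : c ^+ 2 = (inner f f)^-1 by rewrite exprVn sqr_sqrtr ?inner_ge0.
have [_ ub] := @QEC_max R G hG.
rewrite -ler_pdivrMr // mulrC -c2 -inner_distmx_scale; apply: ub.
exists [ffun v => c * f v] => //; split; last by rewrite /= inner_one sum_scale.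
by rewrite /= inner_scale c2 mulVf.
Qed.

Lemma QEC_eq (x : R) : QEC_values R G x -> ubound (QEC_values R G) x -> QEC R G = x.
Proof.
move=> xV xub; apply/eqP; rewrite eq_le; apply/andP; split.
  by apply: ge_sup => //; exists x.
by apply: ub_le_sup => //; exists x.
Qed.

End Rayleigh.

(** * The simple corona *)

Theorem corollary4p7 (R : realType) (G : graph) (hG : (1 < #|G|)%N) :
  QEC R (corona G K1) = QEC R G - 1 + Num.sqrt (1 + QEC R G ^+ 2).
Proof.
set q := QEC R G; set s := Num.sqrt (1 + q ^+ 2).
have s2 : s ^+ 2 = 1 + q ^+ 2 by rewrite sqr_sqrtr // addr_ge0 ?sqr_ge0.
have s0 : 0 <= s by exact: sqrtr_ge0.
(* The factor [m = 2 l + 2] below is [2 (q + s)], positive since [s > |q|]. *)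
have qs : 0 < q + s.
  rewrite ltNge; apply/negP => qs.
  have : 0 <= (q + s) * (q - s) by apply: mulr_le0 => //; lra.
  by rewrite mulrC -subr_sqr s2; lra.
set l := q - 1 + s.
pose m := 2 * l + 2.
have m0 : 0 < m by rewrite /m /l; lra.
have char_eq : (l - q) * m = l ^+ 2.
  by rewrite /m /l; ring: s2.
apply: QEC_eq.
  have [[h [h1 h0] hq] _] := @QEC_max R G hG.
  rewrite /= inner_one in h0.
  (* The ratio of [b] to [g = a + b] is [l / m], the one at which the square
  [(l x - m y)^2] vanishes; [c] makes [corona_fun a b] a unit vector. *)
  pose N := (m - l) ^+ 2 + l ^+ 2.
  have N0 : 0 < N.
    have -> : N = 2 * (l + 1) ^+ 2 + 2 by rewrite /N /m; ring.
    by have := sqr_ge0 (l + 1); lra.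
  pose c := (Num.sqrt N)^-1.
  have c2 : c ^+ 2 = N^-1 by rewrite exprVn sqr_sqrtr ?ltW.
  pose a : {ffun G -> R} := [ffun v => (c * (m - l)) * h v].
  pose b : {ffun G -> R} := [ffun v => (c * l) * h v].
  have gE : [ffun v => a v + b v] = [ffun v => (c * m) * h v] :> {ffun G -> R}.
    by apply/ffunP => v; rewrite !ffunE; ring.
  have g0 : \sum_v (a v + b v) = 0.
    transitivity (\sum_v [ffun v => (c * m) * h v] v); last exact: sum_scale.
    by apply: eq_bigr => v _; rewrite -gE [RHS]ffunE.
  exists (corona_fun R G a b); first split.
  - rewrite /= inner_corona !inner_scale h1 !mulr1 !exprMn -mulrDr c2.
    by rewrite mulVf ?gt_eqF.
  - by rewrite /= inner_one_corona.
  rewrite inner_distmx_corona // gE inner_distmx_scale inner_scale h1 hq -/q.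
  transitivity (N^-1 * (N * l)); last by rewrite mulKf ?gt_eqF.
  transitivity (N^-1 * (N * l - m * ((l - q) * m - l ^+ 2))).
    by rewrite !exprMn c2 /N /m; ring.
  by rewrite char_eq subrr mulr0 subr0.
move=> _ [f [/= f1 f0] <-]; rewrite (corona_funP R G f) in f1 f0 *.
move: f1 f0; set a := (X in corona_fun R G X _); set b := (X in corona_fun R G _ X).
rewrite inner_corona inner_one_corona => f1 g0.
rewrite inner_distmx_corona //; set g := [ffun v => a v + b v].
have gle : inner g (distmx_apply g) <= q * inner g g.
  apply: inner_distmx_le => //; rewrite -[RHS]g0.
  by apply: eq_bigr => v _; rewrite ffunE.
suff key : q * inner g g - 2 * inner b b <= l * (inner a a + inner b b).
  by rewrite f1 in key; lra.
rewrite -subr_ge0 -(pmulr_rge0 _ m0).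
have -> : m * (l * (inner a a + inner b b) - (q * inner g g - 2 * inner b b))
    = \sum_v (l * g v - m * b v) ^+ 2.
  rewrite /inner -big_split !mulr_sumr -!sumrB mulr_sumr /=.
  apply: eq_bigr => v _.
  transitivity ((l - q) * m * g v ^+ 2 - 2 * m * l * g v * b v + (m * b v) ^+ 2).
    by rewrite [g v]ffunE /m; ring.
  by rewrite char_eq; ring.
by apply: sumr_ge0 => v _; exact: sqr_ge0.
Qed.
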